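(* Let $M,\tau>0$ and let $\bar q$ be a Borel probability measure on $\mathbb R$ with $\int e^{\lambda\varphi}\,d\bar q(\varphi)<\infty$ for all $\lambda\in\mathbb R$. Let $g_0\in\mathcal P_*(M)$ be a density that is strictly positive on $[-M,M]$, and let $\{g_t\}_{t\ge0}$ be the solution in $\mathcal P_*(M)$ to $$\frac{d}{dt}g_t(\theta)=g_t(\theta)\left[\int\frac{\mathcal N_\tau(\theta-\varphi)}{[\mathcal N_\tau*g_t](\varphi)}\,d\bar q(\varphi)-1\right],\qquad\theta\in[-M,M],$$ initialized at $g_0$. Then for any $h\in\mathcal P_*(M)$ and any $t>0$, $$\bar F(g_t\mid\bar q)-\bar F(h\mid\bar q)\le\frac{D_{\mathrm{KL}}(h\|g_0)}{t},\qquad\text{where}\quad\bar F(g\mid\bar q):=\int-\log[\mathcal N_\tau*g](\varphi)\,d\bar q(\varphi).$$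
   Context: $\mathcal P_*(M)$ is the set of probability densities on $[-M,M]$ with respect to Lebesgue measure. $\mathcal N_\tau(\cdot)$ is the density of $\mathcal N(0,\tau^2)$, and $[\mathcal N_\tau*g](\varphi)=\int_{-M}^M\mathcal N_\tau(\varphi-\theta)g(\theta)\,d\theta$. $D_{\mathrm{KL}}(h\|g)=\int h\log(h/g)$. A solution of the evolution equation is a family $g_t\in\mathcal P_*(M)$, $t\ge0$, with $t\mapsto g_t(\theta)$ continuously differentiable for every $\theta\in[-M,M]$ and the equation holding pointwise; under the stated hypotheses such a solution exists and is unique. *)

(* Defs.v *)
From HB Require Import structures.
From mathcomp Require Import all_boot all_order all_algebra.
From mathcomp Require Import all_classical all_reals all_analysis.
Import Order.TTheory GRing.Theory Num.Theory.
Import numFieldNormedType.Exports.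

Set Implicit Arguments.
Unset Strict Implicit.
Unset Printing Implicit Defensive.

Local Open Scope classical_set_scope.
Local Open Scope ring_scope.

(* Functions on [-M, M] are represented by total functions R -> R; no
   definition below looks at their values outside [-M, M]. *)
Definition density (R : realType) (M : R) (g : R -> R) : Prop :=
  [/\ measurable_fun `[- M, M] g,
      forall x : R, - M <= x <= M -> 0 <= g x &
      (\int[lebesgue_measure]_(x in `[(- M)%R, M]) (g x)%:E = 1)%E].

Definition gauss_conv (R : realType) (M tau : R) (g : R -> R) (phi : R) : R :=
  \int[lebesgue_measure]_(theta in `[- M, M])
    (normal_pdf 0 tau (phi - theta) * g theta).

(* The quotient and the logarithm are taken in \bar R, so that the integrand is
   0 where h vanishes and +oo where h > 0 = g. *)
Definition kl_div (R : realType) (M : R) (h g : R -> R) : \bar R :=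
  (\int[lebesgue_measure]_(theta in `[(- M)%R, M])
    ((h theta)%:E * lne ((h theta)%:E / (g theta)%:E)))%E.

Definition Fbar (R : realType) (M tau : R)
    (q : probability (measurableTypeR R) R) (g : R -> R) : \bar R :=
  (\int[q]_phi (- ln (gauss_conv M tau g phi))%:E)%E.

Definition velocity (R : realType) (M tau : R)
    (q : probability (measurableTypeR R) R) (g : R -> R) (theta : R) : R :=
  g theta *
    (\int[q]_phi (normal_pdf 0 tau (theta - phi) / gauss_conv M tau g phi) - 1).

(* f is continuously differentiable on [0, +oo[ with derivative df, the
   derivative at 0 being the right-hand one. *)
Definition C1_derivative (R : realType) (f df : R -> R) : Prop :=
  [/\ forall t : R, 0 < t -> is_derive t 1 f (df t),
      (f s - f 0) / s @[s --> 0^'+] --> df 0 &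
      {within `[0, +oo[, continuous df}].

(* In g t theta, the first argument is time; negative times are irrelevant. *)
Definition is_solution (R : realType) (M tau : R)
    (q : probability (measurableTypeR R) R) (g0 : R -> R) (g : R -> R -> R)
    : Prop :=
  [/\ forall t : R, 0 <= t -> density M (g t),
      forall theta : R, - M <= theta <= M ->
        C1_derivative (fun t => g t theta)
                      (fun t => velocity M tau q (g t) theta) &
      forall theta : R, - M <= theta <= M -> g 0 theta = g0 theta].

(* Main.v *)
Require Import Defs.
From HB Require Import structures.
From mathcomp Require Import all_boot all_order all_algebra.
From mathcomp Require Import all_classical all_reals all_analysis.
From mathcomp Require Import measurable_realfun ring lra.
Import Order.TTheory GRing.Theory Num.Theory.
Import numFieldNormedType.Exports.
Local Open Scope classical_set_scope.
Local Open Scope ring_scope.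

(** Let [w_g theta] be the integral of [N_tau(theta - phi) / (N_tau * g)(phi)]
    over [q], so that the flow reads [g' = g (w_g - 1)].  For all densities [g]
    and [h], [log x <= x - 1] and Tonelli's theorem give
      [F g - F h <= int (N_tau * h) / (N_tau * g) dq - 1 = int (w_g - 1) h]
    ([loss_convexity]), and the right-hand side is the rate at which
    [int h log (g_s / g_0)] grows along the flow.  As [int g w_g = 1], the loss
    [F g_s] decreases at the rate [int g (w_g - 1)^2].  Hence
      [t (F g_t - F h) <= int_0^t (F g_s - F h) ds <= int h log (g_t / g_0)
         = KL (h | g_0) - KL (h | g_t) <= KL (h | g_0)]
    when [KL (h | g_0)] is finite, the only case with content.

    Differentiating under the integral signs is avoided.  All the kernels
    [N_tau(phi - theta)], theta in [-M, M], agree up to the factor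
    [tilt phi = exp ((2 M |phi| + M^2) / tau^2)], which the exponential moments
    of [q] make integrable.  So [0 <= w <= weight_bound] for every density,
    the logarithm of the solution is Lipschitz in time uniformly in theta, and
    so are the logarithm of its Gaussian smoothing and, on bounded time
    intervals, [w] ([weight_lipschitzP]).  Over a time
    step of length [d] the two derivative computations above therefore hold up
    to an error [O(d^2)] ([loss_step], [log_gain_step]), and a function whose
    decrease over each step of length [d] is at most [C d^2] is nondecreasing
    ([nondecreasing_of_quadratic_defect]). *)

Set Implicit Arguments.
Unset Strict Implicit.
Unset Printing Implicit Defensive.

(** * The Gaussian kernel *)

Section kernel.
Context {R : realType} (M tau : R).
Hypothesis tau_gt0 : 0 < tau.
Local Notation mu := (@lebesgue_measure R).
Local Notation K x y := (normal_pdf 0 tau (x - y)).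
Local Notation D := (`[- M, M]%classic : set R).

Let tau_neq0 : tau != 0. Proof. by rewrite gt_eqF. Qed.

Lemma kernelE x y :
  K x y = normal_peak tau * expR (- ((x - y) ^+ 2 / (tau ^+ 2 *+ 2))).
Proof. by rewrite normal_pdfE// /normal_fun subr0 mulNr. Qed.

Lemma kernelC x y : K x y = K y x.
Proof. by rewrite !kernelE -opprB sqrrN. Qed.

Lemma kernel_gt0 x y : 0 < K x y.
Proof. by rewrite kernelE mulr_gt0 ?expR_gt0// normal_peak_gt0. Qed.

Definition tilt (phi : R) : R := expR ((2 * M * `|phi| + M ^+ 2) / tau ^+ 2).

Lemma tilt_gt0 phi : 0 < tilt phi. Proof. exact: expR_gt0. Qed.

(** The quadratic terms in [phi] of the two exponents cancel, so their
    difference is affine in [phi] with slope at most [2 * M / tau ^+ 2]. *)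
Lemma kernel_le_tilt phi x y : D x -> D y -> K phi x <= tilt phi * K phi y.
Proof.
rewrite /= !in_itv/= => Dx Dy.
rewrite !kernelE mulrCA ler_wpM2l ?normal_peak_ge0// /tilt -expRD ler_expR.
rewrite -subr_ge0.
have -> : (2 * M * `|phi| + M ^+ 2) / tau ^+ 2 -
    (phi - y) ^+ 2 / (tau ^+ 2 *+ 2) - - ((phi - x) ^+ 2 / (tau ^+ 2 *+ 2)) =
   (2 * (2 * M * `|phi| + M ^+ 2) - (phi - y) ^+ 2 + (phi - x) ^+ 2) /
     (2 * tau ^+ 2).
  by field.
apply: divr_ge0; last by rewrite mulr_ge0// sqr_ge0.
have y2 : y ^+ 2 <= M ^+ 2 by nra.
have x2 := sqr_ge0 x.
have [p0|/ltW p0] := leP 0 phi; [rewrite ger0_norm//|rewrite ler0_norm//].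
  have : 0 <= phi * (2 * M + (y - x)) by rewrite mulr_ge0//; lra.
  nra.
have : 0 <= (- phi) * (2 * M - (y - x)) by rewrite mulr_ge0//; lra.
nra.
Qed.

Lemma measurable_kernel : measurable_fun setT (fun z : R * R => K z.1 z.2).
Proof.
apply: (measurableT_comp (measurable_normal_pdf 0 tau)).
exact: measurable_funB.
Qed.

End kernel.

(** * Averages against a density *)

Section density_integrals.
Context {R : realType} (M : R).
Local Notation mu := (@lebesgue_measure R).
Local Notation D := (`[- M, M]%classic : set R).

Lemma density_ge0 (g : R -> R) : density M g -> forall x, D x -> 0 <= g x.
Proof. by case=> _ g0 _ x /=; rewrite in_itv/=; exact: g0. Qed.

Lemma density_integrable (g : R -> R) : density M g ->
  mu.-integrable D (EFin \o g).
Proof.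
move=> dg; have [mg g0 g1] := dg.
apply/integrableP; split; first exact/measurable_EFinP.
rewrite (_ : (\int[_]_(x in _) _)%E = 1%E) ?ltry// -g1.
by apply: eq_integral => x /set_mem Dx /=; rewrite ger0_norm// (density_ge0 dg).
Qed.

Lemma density_integrableZ (c : R) (g : R -> R) : density M g ->
  mu.-integrable D (EFin \o (fun x => c * g x)).
Proof.
by move=> dg; apply: (@integrableZl _ _ _ mu D _ c (EFin \o g)) => //;
  exact: density_integrable.
Qed.

Lemma density_Rintegral (g : R -> R) : density M g -> \int[mu]_(x in D) g x = 1.
Proof. by case=> _ _ g1; rewrite /Rintegral g1. Qed.

Lemma integrable_densityM (f g : R -> R) (c : R) : density M g ->
  measurable_fun D f -> (forall x, D x -> `|f x| <= c) ->
  mu.-integrable D (EFin \o (fun x => f x * g x)).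
Proof.
move=> dg mf fc.
apply: (@le_integrable _ _ _ mu D _ _ (EFin \o (fun x => c * g x))) => //.
- apply/measurable_EFinP/measurable_funM => //.
  by have [] := dg.
- move=> x Dx /=; have gx := density_ge0 dg Dx.
  have c0 : 0 <= c := le_trans (normr_ge0 _) (fc x Dx).
  rewrite lee_fin normrM (ger0_norm gx) (@ger0_norm _ (c * g x)) ?mulr_ge0//.
  by rewrite ler_wpM2r// fc.
- exact: density_integrableZ.
Qed.

Lemma density_average_le (f g : R -> R) (c C : R) : density M g ->
  measurable_fun D f -> (forall x, D x -> `|f x| <= C) ->
  (forall x, D x -> f x <= c) ->
  \int[mu]_(x in D) (f x * g x) <= c.
Proof.
move=> dg mf fC fc.
rewrite -[leRHS]mulr1 -(density_Rintegral dg) -RintegralZl//; last first.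
  exact: density_integrable.
apply: le_Rintegral => //.
- exact: integrable_densityM fC.
- exact: density_integrableZ.
- by move=> x Dx; rewrite ler_wpM2r ?(density_ge0 dg) ?fc.
Qed.

Lemma density_average_ge (f g : R -> R) (c C : R) : density M g ->
  measurable_fun D f -> (forall x, D x -> `|f x| <= C) ->
  (forall x, D x -> c <= f x) ->
  c <= \int[mu]_(x in D) (f x * g x).
Proof.
move=> dg mf fC fc.
rewrite -[leLHS]mulr1 -(density_Rintegral dg) -RintegralZl//; last first.
  exact: density_integrable.
apply: le_Rintegral => //.
- exact: density_integrableZ.
- exact: integrable_densityM fC.
- by move=> x Dx; rewrite ler_wpM2r ?(density_ge0 dg) ?fc.
Qed.

End density_integrals.

(** * One-variable calculus *)

Section calculus.
Context {R : realType}.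

Lemma C1_derivative_continuous (f df : R -> R) (x : R) :
  C1_derivative f df -> 0 < x -> {for x, continuous f}.
Proof.
move=> [fd _ _] x0; apply: differentiable_continuous.
by apply/derivable1_diffP; have [] := fd _ x0.
Qed.

Lemma C1_derivative_cvg_right (f df : R -> R) (a : R) :
  C1_derivative f df -> 0 <= a -> f x @[x --> a^'+] --> f a.
Proof.
move=> fC; rewrite le_eqVlt => /predU1P[<-|a0]; last first.
  by apply: cvg_at_right_filter; exact: (C1_derivative_continuous fC).
have [_ f0 _] := fC.
have id0 : x @[x --> (0 : R)^'+] --> (0 : R).
  by apply: cvg_at_right_filter; exact: cvg_id.
have fcvg : f 0 + x * ((f x - f 0) / x) @[x --> (0 : R)^'+] --> f 0.
  rewrite -[X in _ --> X]addr0 -[X in _ + X](mul0r (df 0)).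
  by apply: cvgD; [exact: cvg_cst|exact: cvgM].
apply: cvg_trans _ fcvg; apply: near_eq_cvg.
near=> x; rewrite /= mulrC divfK; first by rewrite addrC subrK.
by rewrite gt_eqF//; near: x; exact: nbhs_right_gt.
Unshelve. all: by end_near. Qed.

(** The mean value theorem for [f x * expR (- m * x)], whose derivative has the
    sign of [df - m * f]; this is a Gronwall argument in exact form, and [m = 0]
    gives back the mean value theorem for [f]. *)
Lemma C1_derivative_mvt (f df : R -> R) (m a b : R) :
  C1_derivative f df -> 0 <= a -> a < b ->
  exists c, [/\ a <= c, c <= b, 0 < c &
    f b * expR (- m * b) - f a * expR (- m * a) =
    (df c - m * f c) * expR (- m * c) * (b - a)].
Proof.
move=> fC a0 ab.
pose e (x : R) := expR (- m * x).
have eD (x : R) : is_derive x 1 e (- m * e x).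
  rewrite mulrC.
  apply: (@is_derive1_comp _ expR (fun y => - m * y) x (e x) (- m)).
  have := is_deriveZ (- m) (is_derive_id x (1 : R)).
  by rewrite /GRing.scale/= mulr1.
have ec (x : R) : {for x, continuous e}.
  apply: differentiable_continuous; apply/derivable1_diffP.
  by have [] := eD x.
have [fD _ _] := fC.
have [||c] := @MVT R (f * e) (fun x => (df x - m * f x) * e x) a b ab.
- move=> x; rewrite in_itv/= => /andP[ax _].
  have fx := fD x (le_lt_trans a0 ax).
  apply: is_derive_eq.
  rewrite /GRing.scale/=; ring.
- apply/(continuous_within_itvP _ ab); split.
  + move=> x; rewrite in_itv/= => /andP[ax _].
    apply: continuousM; last exact: ec.
    by apply: (C1_derivative_continuous fC); exact: le_lt_trans ax.
  + apply: cvgM; first exact: C1_derivative_cvg_right fC a0.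
    by apply: cvg_at_right_filter; exact: ec.
  + apply: cvg_at_left_filter; apply: continuousM; last exact: ec.
    by apply: (C1_derivative_continuous fC); exact: le_lt_trans ab.
- rewrite in_itv/= => /andP[ac cb] eq; exists c; split; rewrite ?ltW//.
  exact: le_lt_trans ac.
Qed.

Lemma C1_derivative_growth_ge (f df : R -> R) (m a b : R) :
  C1_derivative f df -> 0 <= a -> a <= b ->
  (forall c, a <= c -> c <= b -> m * f c <= df c) ->
  f a * expR (m * (b - a)) <= f b.
Proof.
move=> fC a0; rewrite le_eqVlt => /predU1P[<-|ab] fm.
  by rewrite subrr mulr0 expR0 mulr1.
have [c [ac cb _ eq]] := C1_derivative_mvt m fC a0 ab.
have : 0 <= f b * expR (- m * b) - f a * expR (- m * a).
  rewrite eq !mulr_ge0 ?expR_ge0 ?subr_ge0 ?fm//; exact: ltW.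
rewrite subr_ge0 (mulNr m b) expRN ler_pdivlMr ?expR_gt0// -mulrA -expRD.
by congr (_ * expR _ <= _); ring.
Qed.

Lemma C1_derivative_growth_le (f df : R -> R) (m a b : R) :
  C1_derivative f df -> 0 <= a -> a <= b ->
  (forall c, a <= c -> c <= b -> df c <= m * f c) ->
  f b <= f a * expR (m * (b - a)).
Proof.
move=> fC a0; rewrite le_eqVlt => /predU1P[<-|ab] fm.
  by rewrite subrr mulr0 expR0 mulr1.
have [c [ac cb _ eq]] := C1_derivative_mvt m fC a0 ab.
have : f b * expR (- m * b) - f a * expR (- m * a) <= 0.
  rewrite eq mulr_le0_ge0 ?subr_ge0 ?(ltW ab)// mulr_le0_ge0 ?expR_ge0//.
  by rewrite subr_le0 fm.
rewrite subr_le0 (mulNr m b) expRN ler_pdivrMr ?expR_gt0// -mulrA -expRD.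
by congr (_ <= _ * expR _); ring.
Qed.

(** Cutting [s, r] into [n] equal steps, the total defect is at most
    [C * (r - s) ^+ 2 / n], which tends to 0. *)
Lemma nondecreasing_of_quadratic_defect (G : R -> R) (C T : R) :
  (forall s r, 0 <= s -> s <= r -> r <= T -> G s - C * (r - s) ^+ 2 <= G r) ->
  forall s r, 0 <= s -> s <= r -> r <= T -> G s <= G r.
Proof.
move=> GC s r s0 sr rT.
have step (n k : nat) : (k <= n.+1)%N ->
    G s - k%:R * (C * ((r - s) / n.+1%:R) ^+ 2) <=
      G (s + k%:R * ((r - s) / n.+1%:R)).
  set d := (r - s) / n.+1%:R.
  have d0 : 0 <= d by rewrite divr_ge0 ?subr_ge0.
  have nd : n.+1%:R * d = r - s by rewrite /d mulrC divfK// pnatr_eq0.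
  elim: k => [_|k IH kn]; first by rewrite !mul0r subr0 addr0.
  have kd0 : 0 <= k%:R * d by rewrite mulr_ge0.
  have kd : k.+1%:R * d <= r - s by rewrite -nd ler_wpM2r// ler_nat.
  have := IH (ltnW kn).
  have := GC (s + k%:R * d) (s + k.+1%:R * d).
  rewrite -[k.+1]addn1 natrD in kd *.
  have -> : s + (k%:R + 1) * d - (s + k%:R * d) = d by ring.
  move=> h1 h2; have {h1} : G (s + k%:R * d) - C * d ^+ 2 <=
      G (s + (k%:R + 1) * d).
    by apply: h1; lra.
  lra.
rewrite leNgt; apply/negP => Grs.
pose N := Num.bound (`|C * (r - s) ^+ 2| / (G s - G r)).
have gap : 0 < G s - G r by rewrite subr_gt0.
have HN : `|C * (r - s) ^+ 2| / (G s - G r) < N.+1%:R.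
  apply: lt_le_trans (archi_boundP _) _; last by rewrite ler_nat.
  by rewrite divr_ge0// ltW.
have := step N N.+1 (leqnn _); have : 0 < N.+1%:R :> R by rewrite ltr0n.
move: HN; move: (N.+1%:R : R) => n HN n0.
have nE : s + n * ((r - s) / n) = r by field; rewrite gt_eqF.
have dE : n * (C * ((r - s) / n) ^+ 2) = C * (r - s) ^+ 2 / n.
  by field; rewrite gt_eqF.
rewrite nE dE; apply/negP; rewrite -ltNge ltrBrDr -ltrBrDl ltr_pdivrMr//.
rewrite (le_lt_trans (ler_norm _))//.
by move: HN; rewrite ltr_pdivrMr// [X in _ < X]mulrC.
Qed.

(** [a * b] is [a ^+ 2] up to the small term [a * (b - a)]. *)
Lemma opp_mul_le_defect (a b K e : R) : `|a| <= K -> `|b - a| <= e ->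
  - (a * b) <= K * e.
Proof.
move=> aK bae.
have : `|a * (b - a)| <= K * e by rewrite normrM; exact: ler_pM.
by rewrite ler_norml => /andP[+ _]; have := sqr_ge0 a; lra.
Qed.

Lemma normr_sub_le_of_ratio (a b k e : R) : a <= k * b -> b <= k * a ->
  (k - 1) * a <= e -> (k - 1) * b <= e -> `|a - b| <= e.
Proof. by move=> *; rewrite ler_norml; apply/andP; split; lra. Qed.

End calculus.

(** * A lower bound for the Kullback-Leibler divergence *)

Section divergence.
Context {R : realType} (M : R).
Local Notation mu := (@lebesgue_measure R).
Local Notation D := (`[- M, M]%classic : set R).

(** Integrability is assumed of the smaller function only, because a divergence
    may be infinite. *)
Lemma le_integral_integrable_left (f e : R -> \bar R) :
  mu.-integrable D f -> measurable_fun D e -> (forall x, D x -> f x <= e x)%E ->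
  (\int[mu]_(x in D) f x <= \int[mu]_(x in D) e x)%E.
Proof.
move=> fi me fe; have mf := measurable_int _ fi.
rewrite integralE [leRHS]integralE leeB//; apply: ge0_le_integral => //.
- exact: measurable_funepos.
- exact: measurable_funepos.
- by move=> x /mem_set; apply: funepos_le => y /set_mem; exact: fe.
- exact: measurable_funeneg.
- exact: measurable_funeneg.
- by move=> x /mem_set; apply: funeneg_le => y /set_mem; exact: fe.
Qed.

Lemma measurable_fun_ln_comp (f : R -> R) :
  measurable_fun D f -> measurable_fun D (fun x : R => ln (f x)).
Proof. by move=> mf; exact: (measurableT_comp (@measurable_ln R) mf). Qed.

(** Formally, the difference of the two sides is [KL (h | g)].  Pointwise,
    [h log (h / g) >= h - g], and [h - g] has integral 0; adding it to the
    left-hand integrand bounds the integrand of [kl_div] from below by an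
    integrable function.  The bound by [C] makes that function integrable. *)
Lemma kl_div_ge (g0 g h : R -> R) (C : R) :
  density M g0 -> density M g -> density M h ->
  (forall x, D x -> 0 < g0 x) -> (forall x, D x -> 0 < g x) ->
  (forall x, D x -> `|ln (g x) - ln (g0 x)| <= C) ->
  ((\int[mu]_(x in D) ((ln (g x) - ln (g0 x)) * h x))%:E <= kl_div M h g0)%E.
Proof.
move=> dg0 dg dh g00 gpos gC.
have [mg0 _ _] := dg0. have [mg _ _] := dg. have [mh _ _] := dh.
have mA : measurable_fun D (fun x => ln (g x) - ln (g0 x)).
  by apply: measurable_funB; exact: measurable_fun_ln_comp.
have klE x : D x -> ((h x)%:E * lne ((h x)%:E / (g0 x)%:E))%E =
    (h x * (ln (h x) - ln (g0 x)))%:E.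
  move=> Dx; rewrite inver gt_eqF ?g00//.
  have := density_ge0 dh Dx; rewrite le_eqVlt => /predU1P[<-|hx].
    by rewrite !mul0e mul0r.
  rewrite -EFinM lne_EFin ?divr_gt0 ?g00// -EFinM.
  by rewrite ln_div ?posrE ?g00.
have iA : mu.-integrable D (EFin \o (fun x => (ln (g x) - ln (g0 x)) * h x)).
  exact: integrable_densityM gC.
have ihg : mu.-integrable D (EFin \o (fun x => h x - g x)).
  by apply: (@integrableB _ _ _ mu D _ (EFin \o _) (EFin \o _)) => //;
    exact: density_integrable.
pose k x := (ln (g x) - ln (g0 x)) * h x + (h x - g x).
have -> : \int[mu]_(x in D) ((ln (g x) - ln (g0 x)) * h x) = \int[mu]_(x in D) k x.
  rewrite /k (RintegralD _ iA ihg)//.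
  rewrite (RintegralB _ (density_integrable dh) (density_integrable dg))//.
  by rewrite (density_Rintegral dh) (density_Rintegral dg) subrr addr0.
have ik : mu.-integrable D (EFin \o k).
  exact: (@integrableD _ _ _ mu D _ (EFin \o _) (EFin \o _)).
rewrite /Rintegral fineK; last exact: integrable_fin_num.
rewrite /kl_div.
rewrite [leRHS](_ : _ =
    \int[mu]_(x in D) (h x * (ln (h x) - ln (g0 x)))%:E)%E; last first.
  by apply: eq_integral => x /set_mem Dx; rewrite klE.
apply: le_integral_integrable_left => //.
  apply/measurable_EFinP; apply: measurable_funM => //.
  by apply: measurable_funB; exact: measurable_fun_ln_comp.
move=> x Dx; rewrite lee_fin /k.
have gx := gpos x Dx.
have := density_ge0 dh Dx; rewrite le_eqVlt => /predU1P[<-|hx].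
  by rewrite !(mul0r, mulr0); lra.
have := @le_ln1Dx R (g x / h x - 1).
have -> : 1 + (g x / h x - 1) = g x / h x by ring.
rewrite ln_div ?posrE// => lnle.
have {lnle} : ln (g x) - ln (h x) <= g x / h x - 1.
  by apply: lnle; have := divr_gt0 gx hx; lra.
rewrite lerBrDr ler_pdivlMr// => lnle; lra.
Qed.

End divergence.

(** * Gaussian smoothing of a density *)

Section smoothing.
Context {R : realType} (M tau : R).
Hypotheses (M_gt0 : 0 < M) (tau_gt0 : 0 < tau).
Local Notation mu := (@lebesgue_measure R).
Local Notation K x y := (normal_pdf 0 tau (x - y)).
Local Notation D := (`[- M, M]%classic : set R).
Local Notation conv := (gauss_conv M tau).
Local Notation tilt := (tilt M tau).

Lemma measurable_kernel_section phi : measurable_fun D (fun x => K phi x).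
Proof.
apply: measurable_funTS; apply: (measurableT_comp (measurable_normal_pdf 0 tau)).
exact: measurable_funB.
Qed.

Lemma kernel_bounded phi x : `|K phi x| <= normal_peak tau.
Proof.
by rewrite ger0_norm ?normal_pdf_ge0// normal_pdf_ub// gt_eqF.
Qed.

Lemma gauss_conv_le g phi c : density M g -> (forall x, D x -> K phi x <= c) ->
  conv g phi <= c.
Proof.
move=> dg Kc; apply: (density_average_le dg _ _ Kc) => [|x _].
  exact: measurable_kernel_section.
exact: kernel_bounded.
Qed.

Lemma gauss_conv_ge g phi c : density M g -> (forall x, D x -> c <= K phi x) ->
  c <= conv g phi.
Proof.
move=> dg Kc; apply: (density_average_ge dg _ _ Kc) => [|x _].
  exact: measurable_kernel_section.
exact: kernel_bounded.
Qed.

(** The smoothed density is an average of kernels, so it is comparable to each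
    of them, whatever the density. *)
Lemma kernel_le_conv g phi x : density M g -> D x ->
  K phi x <= tilt phi * conv g phi.
Proof.
move=> dg Dx; rewrite -ler_pdivrMl ?tilt_gt0//; apply: gauss_conv_ge => // y Dy.
by rewrite ler_pdivrMl ?tilt_gt0// kernel_le_tilt.
Qed.

Lemma conv_le_kernel g phi x : density M g -> D x ->
  conv g phi <= tilt phi * K phi x.
Proof. by move=> dg Dx; apply: gauss_conv_le => // y Dy; exact: kernel_le_tilt. Qed.

Lemma conv_le_conv g h phi : density M g -> density M h ->
  conv h phi <= tilt phi * conv g phi.
Proof. by move=> dg dh; apply: gauss_conv_le => // y Dy; exact: kernel_le_conv. Qed.

Let D0 : D 0. Proof. by rewrite /= in_itv/=; have := M_gt0; lra. Qed.

Lemma gauss_conv_gt0 g phi : density M g -> 0 < conv g phi.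
Proof.
move=> dg; have := kernel_le_conv phi dg D0.
by move/(lt_le_trans (kernel_gt0 tau_gt0 _ _)); rewrite pmulr_rgt0 ?tilt_gt0.
Qed.

Lemma density_restrict_ge0 g x : density M g -> 0 <= (g \_ D) x.
Proof.
by move=> dg; rewrite patchE; case: ifPn => // /set_mem; exact: (density_ge0 dg).
Qed.

Lemma density_restrict_measurable g : density M g -> measurable_fun setT (g \_ D).
Proof. by case=> mg _ _; exact: (measurable_restrictT _ (measurable_itv _)).1. Qed.

Lemma measurable_gauss_conv g : density M g -> measurable_fun setT (conv g).
Proof.
move=> dg.
pose f (z : R * R) := (K z.1 z.2 * (g \_ D) z.2)%:E.
have mf : measurable_fun setT f.
  apply/measurable_EFinP; apply: measurable_funM.
    exact: measurable_kernel.
  by apply: measurableT_comp => //; exact: density_restrict_measurable.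
have f0 z : (0 <= f z)%E.
  by rewrite lee_fin mulr_ge0 ?normal_pdf_ge0// density_restrict_ge0.
have := measurable_fun_fubini_tonelli_F (m2 := mu) f mf f0.
move/(measurableT_comp (@fine_measurable R setT measurableT)).
apply: eq_measurable_fun => phi _; rewrite /= /gauss_conv Rintegral_mkcond.
rewrite /Rintegral; congr fine; apply: eq_integral => x _; congr EFin.
by rewrite !patchE; case: ifPn => // _; rewrite mulr0.
Qed.

Lemma gauss_conv_le_scale g h c phi : density M g -> density M h ->
  (forall x, D x -> h x <= c * g x) -> conv h phi <= c * conv g phi.
Proof.
move=> dg dh hg; have iK := integrable_densityM _ _ (fun x _ => kernel_bounded phi x).
rewrite /gauss_conv -RintegralZl//; last first.
  by apply: iK => //; exact: measurable_kernel_section.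
apply: le_Rintegral => //.
- by apply: iK => //; exact: measurable_kernel_section.
- apply: (@integrableZl _ _ _ mu D _ c (EFin \o _)) => //.
  by apply: iK => //; exact: measurable_kernel_section.
- by move=> x Dx; rewrite mulrCA ler_wpM2l ?normal_pdf_ge0 ?hg.
Qed.

End smoothing.

(** * Integration against the data distribution *)

Section data.
Context {R : realType} (M tau : R).
Hypotheses (M_gt0 : 0 < M) (tau_gt0 : 0 < tau).
Variable q : probability (measurableTypeR R) R.
Hypothesis q_exp : forall lambda : R,
  (\int[q]_phi (expR (lambda * phi))%:E < +oo)%E.
Local Notation mu := (@lebesgue_measure R).
Local Notation K x y := (normal_pdf 0 tau (x - y)).
Local Notation D := (`[- M, M]%classic : set R).
Local Notation conv := (gauss_conv M tau).
Local Notation tilt := (tilt M tau).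

Lemma integrable_exp (a : R) :
  q.-integrable setT (EFin \o (fun phi => expR (a * phi))).
Proof.
apply/integrableP; split.
  by apply/measurable_EFinP; apply: measurableT_comp => //.
rewrite (le_lt_trans _ (q_exp a))//; apply: ge0_le_integral => //.
- by apply/measurable_EFinP; do 2 apply: measurableT_comp => //.
- by apply/measurable_EFinP; apply: measurableT_comp => //.
- by move=> x _; rewrite /= ger0_norm ?expR_ge0.
Qed.

Lemma integrable_exp_norm (a : R) :
  q.-integrable setT (EFin \o (fun phi => expR (a * `|phi|))).
Proof.
apply: (@le_integrable _ _ _ q setT _ _
  (EFin \o (fun phi => expR (a * phi) + expR (- a * phi)))) => //.
- apply/measurable_EFinP; apply: measurableT_comp => //.
  exact: measurableT_comp.
- move=> x _ /=; rewrite lee_fin (ger0_norm (expR_ge0 _)).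
  rewrite (@ger0_norm _ (_ + _)) ?addr_ge0 ?expR_ge0//.
  have [x0|/ltW x0] := leP 0 x; first by rewrite ger0_norm// lerDl expR_ge0.
  by rewrite ler0_norm// mulrN -mulNr lerDr expR_ge0.
- apply: (@integrableD _ _ _ q setT _ (EFin \o _) (EFin \o _)) => //.
    exact: integrable_exp.
  exact: integrable_exp.
Qed.

Lemma integrable_tilt : q.-integrable setT (EFin \o tilt).
Proof.
have -> : tilt = fun phi => expR (M ^+ 2 / tau ^+ 2) *
    expR (2 * M / tau ^+ 2 * `|phi|).
  apply/funext => phi; rewrite -expRD; congr expR; field.
  by rewrite gt_eqF.
apply: (@integrableZl _ _ _ q setT _ _ (EFin \o _)) => //.
exact: integrable_exp_norm.
Qed.

Lemma q_integrable (f : R -> R) : measurable_fun setT f ->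
  (forall phi, `|f phi| <= tilt phi) -> q.-integrable setT (EFin \o f).
Proof.
move=> mf ft; apply: (le_integrable measurableT _ _ integrable_tilt).
  exact/measurable_EFinP.
move=> x _ /=; rewrite lee_fin (le_trans (ft _))//.
by rewrite ger0_norm// ltW// tilt_gt0.
Qed.

Lemma Rintegral_prob_cst (c : R) : \int[q]_phi c = c.
Proof.
rewrite Rintegral_cst// -[RHS]mulr1; congr (_ * _).
by rewrite -[RHS]/(fine 1%E) -(@probability_setT _ _ _ q).
Qed.

(** Minus the first variation of the loss at [g]: the flow is
    [g' = g * (weight g - 1)]. *)
Definition weight (g : R -> R) (theta : R) : R :=
  \int[q]_phi (K theta phi / conv g phi).

Definition weight_bound : R := \int[q]_phi tilt phi.

Lemma measurable_inv_conv g : density M g ->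
  measurable_fun setT (fun phi => (conv g phi)^-1).
Proof.
move=> dg.
(* Positivity lets the inverse be written with measurable functions. *)
have -> : (fun phi => (conv g phi)^-1) = (fun phi => expR (- ln (conv g phi))).
  by apply/funext => phi; rewrite expRN lnK// posrE gauss_conv_gt0.
apply: measurableT_comp => //; apply: measurableT_comp => //.
apply: (measurableT_comp (@measurable_ln R)); exact: measurable_gauss_conv.
Qed.

Lemma kernel_div_conv_le g theta phi : density M g -> D theta ->
  K theta phi / conv g phi <= tilt phi.
Proof.
move=> dg Dx; rewrite ler_pdivrMr ?gauss_conv_gt0// kernelC//.
exact: kernel_le_conv.
Qed.

Lemma kernel_div_conv_ge0 g theta phi : density M g ->
  0 <= K theta phi / conv g phi.
Proof. by move=> dg; rewrite divr_ge0 ?normal_pdf_ge0// ltW// gauss_conv_gt0. Qed.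

Lemma weight_integrable g theta : density M g -> D theta ->
  q.-integrable setT (EFin \o (fun phi => K theta phi / conv g phi)).
Proof.
move=> dg Dx; apply: q_integrable => [|phi].
  apply: measurable_funM; last exact: measurable_inv_conv.
  by apply: (measurableT_comp (measurable_normal_pdf 0 tau)); exact: measurable_funB.
by rewrite ger0_norm ?kernel_div_conv_ge0 ?kernel_div_conv_le.
Qed.

Lemma weight_ge0 g theta : density M g -> 0 <= weight g theta.
Proof. by move=> dg; apply: Rintegral_ge0 => phi _; exact: kernel_div_conv_ge0. Qed.

Lemma weight_le g theta : density M g -> D theta -> weight g theta <= weight_bound.
Proof.
move=> dg Dx; apply: le_Rintegral => //.
- exact: weight_integrable.
- exact: integrable_tilt.
- by move=> phi _; exact: kernel_div_conv_le.
Qed.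

Lemma weight_bound_ge0 : 0 <= weight_bound.
Proof. by apply: Rintegral_ge0 => phi _; rewrite ltW// tilt_gt0. Qed.

Lemma weight_le_scale g1 g2 c theta : density M g1 -> density M g2 -> 0 <= c ->
  (forall x, D x -> g1 x <= c * g2 x) -> D theta ->
  weight g2 theta <= c * weight g1 theta.
Proof.
move=> d1 d2 c0 g12 Dx; rewrite /weight -RintegralZl//; last first.
  exact: weight_integrable.
apply: le_Rintegral => //.
- exact: weight_integrable.
- apply: (@integrableZl _ _ _ q setT _ _ (EFin \o _)) => //.
  exact: weight_integrable.
- move=> phi _; rewrite ler_pdivrMr ?gauss_conv_gt0//.
  have -> : c * (K theta phi / conv g1 phi) * conv g2 phi =
      K theta phi * (c * conv g2 phi) / conv g1 phi by ring.
  rewrite ler_pdivlMr ?gauss_conv_gt0// ler_wpM2l ?normal_pdf_ge0//.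
  exact: gauss_conv_le_scale.
Qed.

Let ratio g (z : R * R) : R := K z.2 z.1 / conv g z.1.

Let measurable_ratio g : density M g -> measurable_fun setT (ratio g).
Proof.
move=> dg; apply: measurable_funM.
  by apply: (measurableT_comp (measurable_normal_pdf 0 tau)); exact: measurable_funB.
exact: (measurableT_comp (measurable_inv_conv dg)).
Qed.

Lemma measurable_weight g : density M g -> measurable_fun setT (weight g).
Proof.
move=> dg.
have mf : measurable_fun setT (EFin \o ratio g).
  by apply/measurable_EFinP; exact: measurable_ratio.
have f0 z : (0 <= (EFin \o ratio g) z)%E by rewrite lee_fin kernel_div_conv_ge0.
have := measurable_fun_fubini_tonelli_G (m1 := q) _ mf f0.
by move/(measurableT_comp (@fine_measurable R setT measurableT)).
Qed.

(** Tonelli's theorem for the nonnegative function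
    [K theta phi * h theta / conv g phi]. *)
Lemma weight_duality g h : density M g -> density M h ->
  \int[mu]_(theta in D) (weight g theta * h theta) =
  \int[q]_phi (conv h phi / conv g phi).
Proof.
move=> dg dh.
(* Extending [h] by 0 turns the integral over [D] into one over the line. *)
pose f (z : R * R) := ((K z.2 z.1 / conv g z.1) * (h \_ D) z.2)%:E.
have mh := density_restrict_measurable dh.
have mf : measurable_fun setT f.
  apply/measurable_EFinP; apply: measurable_funM.
    exact: measurable_ratio.
  exact: measurableT_comp.
have f0 z : (0 <= f z)%E.
  by rewrite lee_fin mulr_ge0 ?kernel_div_conv_ge0// density_restrict_ge0.
have := fubini_tonelli (m1 := q) (m2 := mu) f mf f0.
rewrite /Rintegral => fub; congr fine; symmetry.
transitivity (\int[q]_phi \int[mu]_x f (phi, x))%E.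
  apply: eq_integral => phi _.
  have -> : (\int[mu]_x f (phi, x) =
      \int[mu]_(x in D) ((conv g phi)^-1 * (K phi x * h x))%:E)%E.
    rewrite [RHS]integral_mkcond; apply: eq_integral => x _.
    rewrite /f /= !patchE; case: ifPn => _; last by rewrite mulr0.
    by rewrite kernelC// mulrA (mulrC _ (K phi x)).
  rewrite mulrC EFinM.
  have iK : mu.-integrable D (EFin \o (fun x => K phi x * h x)).
    apply: integrable_densityM => //; first exact: measurable_kernel_section.
    by move=> x _; exact: kernel_bounded.
  under [RHS]eq_integral do rewrite EFinM.
  rewrite integralZl//; congr (_ * _)%E.
  by rewrite /gauss_conv /Rintegral fineK//; exact: integrable_fin_num.
rewrite fub [RHS]integral_mkcond; apply: eq_integral => x _.
rewrite patchE; case: ifPn => [/set_mem Dx|Dx]; last first.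
  rewrite (eq_integral (cst 0%E)) ?integral0// => phi _.
  by rewrite /f /= patchE (negbTE Dx) mulr0.
rewrite EFinM /weight /Rintegral fineK; last first.
  by apply: integrable_fin_num => //; exact: weight_integrable.
rewrite -integralZr//; last exact: weight_integrable.
by apply: eq_integral => phi _; rewrite /f /= patchE mem_set.
Qed.

Lemma weight_mean g : density M g ->
  \int[mu]_(theta in D) (weight g theta * g theta) = 1.
Proof.
move=> dg; rewrite weight_duality// -[RHS](Rintegral_prob_cst 1).
by apply: eq_Rintegral => phi _; rewrite divff// gt_eqF// gauss_conv_gt0.
Qed.

Lemma conv_ratio_integrable g h : density M g -> density M h ->
  q.-integrable setT (EFin \o (fun phi => conv h phi / conv g phi)).
Proof.
move=> dg dh; apply: q_integrable => [|phi].
  apply: measurable_funM; last exact: measurable_inv_conv.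
  exact: measurable_gauss_conv.
rewrite ger0_norm; last by rewrite divr_ge0// ltW// gauss_conv_gt0.
by rewrite ler_pdivrMr ?gauss_conv_gt0// conv_le_conv.
Qed.

(** Since [conv g phi] is comparable to [K phi 0] up to [tilt phi], its
    logarithm grows at most quadratically in [phi]. *)
Lemma ln_conv_integrable g : density M g ->
  q.-integrable setT (EFin \o (fun phi => ln (conv g phi))).
Proof.
move=> dg.
pose a := `|ln (normal_peak tau)| + (tau ^+ 2)^-1 +
  (2 * M + M ^+ 2) / tau ^+ 2.
apply: (@le_integrable _ _ _ q setT _ _
    (EFin \o (fun phi => a * expR (1 * `|phi|)))) => //.
- apply/measurable_EFinP; apply: (measurableT_comp (@measurable_ln R)).
  exact: measurable_gauss_conv.
- move=> phi _ /=; rewrite lee_fin.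
  have D0 : D 0 by rewrite /= in_itv/=; have := M_gt0; lra.
  have P0 := gauss_conv_gt0 M_gt0 tau_gt0 phi dg.
  have K0 := kernel_gt0 tau_gt0 phi 0.
  have lnK0 : ln (K phi 0) = ln (normal_peak tau) - phi ^+ 2 / (tau ^+ 2 *+ 2).
    rewrite kernelE// lnM ?posrE ?expR_gt0 ?normal_peak_gt0 ?gt_eqF// expRK.
    by rewrite subr0.
  have lnt : ln (tilt phi) = (2 * M * `|phi| + M ^+ 2) / tau ^+ 2.
    by rewrite /tilt expRK.
  have up : ln (conv g phi) <= ln (tilt phi) + ln (K phi 0).
    rewrite -lnM ?posrE ?tilt_gt0// ler_ln ?posrE ?mulr_gt0 ?tilt_gt0//.
    exact: conv_le_kernel.
  have lo : ln (K phi 0) <= ln (tilt phi) + ln (conv g phi).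
    rewrite -lnM ?posrE ?tilt_gt0// ler_ln ?posrE ?mulr_gt0 ?tilt_gt0//.
    exact: kernel_le_conv.
  have e1 : `|phi| <= expR `|phi| by have := expR_ge1Dx `|phi|; lra.
  have e0 : 1 <= expR `|phi|.
    by have := expR_ge1Dx `|phi|; have := normr_ge0 phi; lra.
  have e2 : phi ^+ 2 / 2 <= expR `|phi|.
    have := expR_ge1Dxn 1 (normr_ge0 phi).
    rewrite real_normK ?num_real// (_ : (_ `!)%:R = 2 :> R)//; lra.
  have t0 : 0 < (tau ^+ 2)^-1 by rewrite invr_gt0 exprn_gt0.
  have M2 : 0 <= 2 * M + M ^+ 2 by have := M_gt0; nra.
  have a0 : 0 <= a by rewrite !addr_ge0 ?mulr_ge0 ?(ltW t0).
  rewrite (@ger0_norm _ (a * _)) ?mulr_ge0 ?expR_ge0//.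
  rewrite mul1r.
  have {}lnK0 : ln (K phi 0) = ln (normal_peak tau) - phi ^+ 2 / 2 * (tau ^+ 2)^-1.
    by rewrite lnK0; congr (_ - _); field; rewrite gt_eqF.
  apply: (@le_trans _ _ (`|ln (normal_peak tau)| + phi ^+ 2 / 2 * (tau ^+ 2)^-1 +
      (2 * M * `|phi| + M ^+ 2) / tau ^+ 2)).
    have p0 : 0 <= phi ^+ 2 / 2 * (tau ^+ 2)^-1.
      by rewrite mulr_ge0 ?divr_ge0 ?sqr_ge0 ?ltW.
    have := ler_norm (ln (normal_peak tau)).
    have := ler_norm (- ln (normal_peak tau)); rewrite normrN => n1 n2.
    by rewrite ler_norml; apply/andP; split; lra.
  have h1 : `|ln (normal_peak tau)| <= `|ln (normal_peak tau)| * expR `|phi|.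
    by rewrite ler_peMr.
  have h2 : phi ^+ 2 / 2 * (tau ^+ 2)^-1 <= (tau ^+ 2)^-1 * expR `|phi|.
    by rewrite mulrC ler_wpM2l// ltW.
  have h3 : (2 * M * `|phi| + M ^+ 2) / tau ^+ 2 <=
      (2 * M + M ^+ 2) / tau ^+ 2 * expR `|phi|.
    rewrite [leRHS]mulrAC ler_wpM2r ?(ltW t0)//.
    have m1 : M * `|phi| <= M * expR `|phi| by rewrite ler_wpM2l// ltW.
    have m2 : M ^+ 2 <= M ^+ 2 * expR `|phi| by rewrite ler_peMr// sqr_ge0.
    lra.
  by rewrite /a; lra.
- apply: (@integrableZl _ _ _ q setT _ _ (EFin \o _)) => //.
  exact: integrable_exp_norm.
Qed.

(** [Fbar] as a real number ([FbarE]). *)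
Definition loss (g : R -> R) : R := \int[q]_phi (- ln (conv g phi)).

Let neg_ln_conv_integrable g : density M g ->
  q.-integrable setT (EFin \o (fun phi => - ln (conv g phi))).
Proof.
move=> dg; rewrite (_ : _ \o _ = -%E \o (EFin \o (fun phi => ln (conv g phi))))//.
by apply: integrableN => //; exact: ln_conv_integrable.
Qed.

Lemma FbarE g : density M g -> Fbar M tau q g = (loss g)%:E.
Proof.
move=> dg; rewrite /Fbar /loss /Rintegral fineK//.
by apply: integrable_fin_num => //; exact: neg_ln_conv_integrable.
Qed.

(** The tangent inequality of the convex functional [loss] at [g], obtained from
    [ln x <= x - 1] at [x = conv h phi / conv g phi]. *)
Lemma loss_convexity g h : density M g -> density M h ->
  loss g - loss h <= \int[mu]_(theta in D) (weight g theta * h theta) - 1.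
Proof.
move=> dg dh; rewrite weight_duality// /loss.
have i1 : q.-integrable setT (EFin \o cst 1) by exact: finite_measure_integrable_cst.
rewrite -RintegralB//; [|exact: neg_ln_conv_integrable..].
rewrite -[X in _ - X](Rintegral_prob_cst 1) -RintegralB//; last first.
  exact: conv_ratio_integrable.
apply: le_Rintegral => //.
- apply: (@integrableB _ _ _ q setT _ (EFin \o _) (EFin \o _)) => //;
    exact: neg_ln_conv_integrable.
- apply: (@integrableB _ _ _ q setT _ (EFin \o _) (EFin \o _)) => //.
  exact: conv_ratio_integrable.
- move=> phi _.
  have Pg := gauss_conv_gt0 M_gt0 tau_gt0 phi dg.
  have Ph := gauss_conv_gt0 M_gt0 tau_gt0 phi dh.
  have r0 : 0 < conv h phi / conv g phi by rewrite divr_gt0.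
  have := @le_ln1Dx R (conv h phi / conv g phi - 1).
  have -> : 1 + (conv h phi / conv g phi - 1) = conv h phi / conv g phi by ring.
  rewrite ln_div ?posrE// => lnle.
  suff /lnle : - 1 < conv h phi / conv g phi - 1 by lra.
  by lra.
Qed.

(** * The flow *)

Variables (g0 : R -> R) (g : R -> R -> R).
Hypothesis g_sol : is_solution M tau q g0 g.
Hypothesis g0_gt0 : forall theta : R, - M <= theta <= M -> 0 < g0 theta.

Local Notation L := (weight_bound + 1).
Local Notation w s := (weight (g s)).

Let dens s : 0 <= s -> density M (g s). Proof. by have [+ _ _] := g_sol; apply. Qed.

Lemma solution_C1 theta : D theta ->
  C1_derivative (g ^~ theta) (fun s => g s theta * (w s theta - 1)).
Proof. by move=> Dx; have [_ + _] := g_sol; apply; move: Dx; rewrite /= in_itv. Qed.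

(* Kept folded: comparing these integrals at two different times by unfolding
   them is costly. *)
Local Opaque weight loss.

Lemma rate_ge0 : 0 <= L.
Proof. by rewrite addr_ge0// weight_bound_ge0. Qed.

Lemma rate_bound s theta : 0 <= s -> D theta -> `|w s theta - 1| <= L.
Proof.
move=> s0 Dx; have := weight_ge0 theta (dens s0).
have := weight_le (dens s0) Dx => w1 w0; have := weight_bound_ge0.
by rewrite ler_norml => W0; apply/andP; split; lra.
Qed.

(** With [solution_upper]: the logarithmic derivative [w - 1] of the solution is
    between [- L] and [L], uniformly in [theta]. *)
Lemma solution_lower s r theta : 0 <= s -> s <= r -> D theta ->
  g s theta <= expR (L * (r - s)) * g r theta.
Proof.
move=> s0 sr Dx.
have := C1_derivative_growth_ge (m := - L) (solution_C1 Dx) s0 sr.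
rewrite mulNr expRN ler_pdivrMr ?expR_gt0// [X in _ <= X]mulrC; apply => c sc cr.
have c0 := le_trans s0 sc.
rewrite /= [X in X <= _]mulrC ler_wpM2l ?(density_ge0 (dens c0))//.
by have := rate_bound c0 Dx; rewrite ler_norml => /andP[].
Qed.

Lemma solution_upper s r theta : 0 <= s -> s <= r -> D theta ->
  g r theta <= expR (L * (r - s)) * g s theta.
Proof.
move=> s0 sr Dx; rewrite mulrC.
apply: (C1_derivative_growth_le (solution_C1 Dx) s0 sr) => c sc cr.
have c0 := le_trans s0 sc.
rewrite /= [X in _ <= X]mulrC ler_wpM2l ?(density_ge0 (dens c0))//.
by have := rate_bound c0 Dx; rewrite ler_norml => /andP[].
Qed.

Lemma solution_gt0 s theta : 0 <= s -> D theta -> 0 < g s theta.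
Proof.
move=> s0 Dx; have := solution_lower (lexx 0) s0 Dx.
have [_ _ ->] := g_sol; last by move: Dx; rewrite /= in_itv.
move/(lt_le_trans _) => /(_ 0); rewrite g0_gt0 => [/(_ isT)|].
  by rewrite pmulr_rgt0 ?expR_gt0.
by move: Dx; rewrite /= in_itv.
Qed.

Variable T : R.
Hypothesis T_gt0 : 0 < T.

Definition weight_lipschitz : R := L * expR (L * T) * weight_bound.

Lemma weight_lipschitz_ge0 : 0 <= weight_lipschitz.
Proof. by rewrite !mulr_ge0 ?expR_ge0 ?rate_ge0 ?weight_bound_ge0. Qed.

Let expR_rate d : 0 <= d -> d <= T -> expR (L * d) - 1 <= L * expR (L * T) * d.
Proof.
move=> d0 dT; have := expR_ge1Dx (- (L * d)); rewrite expRN => h.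
have Ld : 0 <= L * d by rewrite mulr_ge0// rate_ge0.
apply: (@le_trans _ _ (L * d * expR (L * d))).
  have := expR_gt0 (L * d) => e0.
  have : (1 - L * d) * expR (L * d) <= 1 by rewrite -ler_pdivlMr// mul1r.
  lra.
by rewrite [leLHS]mulrAC ler_wpM2r// ler_wpM2l ?rate_ge0// ler_expR ler_wpM2l// rate_ge0.
Qed.

(** Scaling a density by at most [k] scales its weight by at most [k] in the
    other direction, and [k = expR (L * (r - s))] is [1 + O(r - s)]. *)
Lemma weight_lipschitzP s r theta : 0 <= s -> s <= r -> r <= T -> D theta ->
  `|w r theta - w s theta| <= weight_lipschitz * (r - s).
Proof.
move=> s0 sr rT Dx; have r0 := le_trans s0 sr.
have e0 := expR_ge0 (L * (r - s)).
have h1 := weight_le_scale (dens s0) (dens r0) e0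
  (fun x => @solution_lower s r x s0 sr) Dx.
have h2 := weight_le_scale (dens r0) (dens s0) e0
  (fun x => @solution_upper s r x s0 sr) Dx.
have e1 : expR (L * (r - s)) - 1 <= L * expR (L * T) * (r - s).
  by apply: expR_rate; rewrite ?subr_ge0// lerBlDr (le_trans rT)// lerDl.
have e2 : 0 <= expR (L * (r - s)) - 1.
  by rewrite subr_ge0 -[X in X <= _]expR0 ler_expR mulr_ge0 ?rate_ge0 ?subr_ge0.
have key v : 0 <= v -> v <= weight_bound ->
    (expR (L * (r - s)) - 1) * v <= weight_lipschitz * (r - s).
  move=> v0 vW; rewrite /weight_lipschitz mulrAC; exact: ler_pM.
apply: (normr_sub_le_of_ratio h1 h2); apply: key.
- exact: weight_ge0 (dens r0).
- exact: weight_le (dens r0) Dx.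
- exact: weight_ge0 (dens s0).
- exact: weight_le (dens s0) Dx.
Qed.

Let defect := L * weight_lipschitz * expR (L * T).

(** By [loss_convexity] at [g r] and [weight_mean], the left-hand side is at most
    the integral of [(g s - g r) * (w r - 1)].  By the mean value theorem
    [g r - g s = (r - s) * g c * (w c - 1)], and [(w c - 1) * (w r - 1)] is
    nonnegative up to [O(r - s)] because [w] is Lipschitz.  The time [c]
    depends on [theta], so it is eliminated before integrating. *)
Lemma loss_step s r : 0 <= s -> s <= r -> r <= T ->
  loss (g r) - loss (g s) <= defect * (r - s) ^+ 2.
Proof.
move=> s0; rewrite le_eqVlt => /predU1P[<-|sr] rT.
  by rewrite !subrr expr0n/= mulr0.
have r0 : 0 <= r by lra.
have [dr ds] := (dens r0, dens s0).
apply: le_trans (loss_convexity dr ds) _.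
have mw : measurable_fun D (w r) by apply: measurable_funTS; exact: measurable_weight.
have wb x : D x -> `|w r x| <= weight_bound.
  by move=> Dx; rewrite ger0_norm ?weight_ge0 ?weight_le.
have iw f : density M f -> mu.-integrable D (EFin \o (fun x => w r x * f x)).
  by move=> df; exact: integrable_densityM wb.
(* [g s] and [g r] have the same mass, and [g r] has mean weight 1. *)
have -> : \int[mu]_(x in D) (w r x * g s x) - 1 =
    \int[mu]_(x in D) ((w r x * g s x - g s x) - (w r x * g r x - g r x)).
  have iB f : density M f ->
      mu.-integrable D (EFin \o (fun x => w r x * f x - f x)).
    move=> df; apply: (@integrableB _ _ _ mu D _ (EFin \o _) (EFin \o _)) => //.
      exact: iw.
    exact: density_integrable.
  rewrite (RintegralB _ (iB _ ds) (iB _ dr))//.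
  rewrite (RintegralB _ (iw _ ds) (density_integrable ds))//.
  rewrite (RintegralB _ (iw _ dr) (density_integrable dr))//.
  by rewrite (weight_mean dr) (density_Rintegral ds) (density_Rintegral dr); ring.
(* The pointwise bound is a multiple of [g r], which has mass 1. *)
rewrite -[leRHS]mulr1 -(density_Rintegral dr) -RintegralZl//; last first.
  exact: density_integrable.
apply: le_Rintegral => //.
- apply: (@integrableB _ _ _ mu D _ (EFin \o _) (EFin \o _)) => //;
    apply: (@integrableB _ _ _ mu D _ (EFin \o _) (EFin \o _)) => //;
    [exact: iw|exact: density_integrable|exact: iw|exact: density_integrable].
- exact: density_integrableZ.
move=> x Dx.
have [c [sc cr c0]] := C1_derivative_mvt 0 (solution_C1 Dx) s0 sr.
rewrite /= oppr0 !mul0r expR0 !mulr1 subr0 => mvt.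
have gc := density_ge0 (dens (ltW c0)) Dx.
pose a := w c x - 1; pose b := w r x - 1.
have {}mvt : g r x - g s x = g c x * a * (r - s) := mvt.
have -> : w r x * g s x - g s x - (w r x * g r x - g r x) =
    - (a * b) * ((r - s) * g c x).
  transitivity (- ((g r x - g s x) * b)); first by rewrite /b; ring.
  by rewrite mvt; ring.
have ab : - (a * b) <= L * (weight_lipschitz * (r - s)).
  apply: opp_mul_le_defect; first exact: rate_bound (ltW c0) Dx.
  have -> : b - a = w r x - w c x by rewrite /a /b opprB addrA subrK.
  apply: le_trans (weight_lipschitzP (ltW c0) cr rT Dx) _.
  by rewrite ler_wpM2l ?weight_lipschitz_ge0// lerB.
have rs0 : 0 <= r - s by rewrite subr_ge0 ltW.
have l0 := weight_lipschitz_ge0. have L0 := rate_ge0.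
have gcr : g c x <= expR (L * T) * g r x.
  apply: le_trans (solution_lower (ltW c0) cr Dx) _.
  rewrite ler_wpM2r ?(density_ge0 dr)// ler_expR ler_wpM2l//; lra.
apply: (@le_trans _ _ (L * (weight_lipschitz * (r - s)) * ((r - s) * g c x))).
  by rewrite ler_wpM2r// mulr_ge0.
rewrite /defect.
have -> : L * weight_lipschitz * expR (L * T) * (r - s) ^+ 2 * g r x =
  L * (weight_lipschitz * (r - s)) * ((r - s) * (expR (L * T) * g r x)) by ring.
apply: ler_wpM2l; last exact: ler_wpM2l.
by apply: mulr_ge0 => //; apply: mulr_ge0.
Qed.

Lemma loss_nonincreasing s r : 0 <= s -> s <= r -> r <= T ->
  loss (g r) <= loss (g s).
Proof.
move=> s0 sr rT; rewrite -lerN2.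
apply: (@nondecreasing_of_quadratic_defect _ (fun s => - loss (g s)) defect T) => //.
by move=> u v u0 uv vT; rewrite -opprD lerN2 -lerBlDl; exact: loss_step.
Qed.

Variable h : R -> R.
Hypothesis h_density : density M h.

(** Formally [KL (h | g0) - KL (h | g s)], but finite even when both divergences
    are infinite, because the logarithmic ratio is bounded. *)
Definition log_gain s : R :=
  \int[mu]_(x in D) ((ln (g s x) - ln (g0 x)) * h x).

Lemma log_ratio_bound s x : 0 <= s -> D x ->
  `|ln (g s x) - ln (g0 x)| <= L * s.
Proof.
move=> s0 Dx.
have gx := solution_gt0 s0 Dx.
have g00 : 0 < g0 x by apply: g0_gt0; move: Dx; rewrite /= in_itv.
have := solution_lower (lexx 0) s0 Dx; have := solution_upper (lexx 0) s0 Dx.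
have [_ _ ->] := g_sol; last by move: Dx; rewrite /= in_itv.
rewrite subr0 -ler_ln ?posrE ?mulr_gt0 ?expR_gt0// => up.
rewrite -ler_ln ?posrE ?mulr_gt0 ?expR_gt0// => lo.
move: up lo; rewrite !lnM ?posrE ?expR_gt0// expRK => up lo.
by rewrite ler_norml; apply/andP; split; lra.
Qed.

Hypothesis g0_density : density M g0.

Lemma log_gain_integrable s : 0 <= s ->
  mu.-integrable D (EFin \o (fun x => (ln (g s x) - ln (g0 x)) * h x)).
Proof.
move=> s0; apply: integrable_densityM => //.
  have [mg _ _] := dens s0; have [mg0 _ _] := g0_density.
  by apply: measurable_funB; exact: measurable_fun_ln_comp.
by move=> x Dx; exact: log_ratio_bound.
Qed.

(** On [s, r] the logarithmic derivative of the solution is at least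
    [w s - 1 - O(r - s)]; averaging against [h] gives the tangent term of
    [loss_convexity] at [g s]. *)
Lemma log_gain_step s r : 0 <= s -> s <= r -> r <= T ->
  (r - s) * (loss (g s) - loss h) - weight_lipschitz * (r - s) ^+ 2 <=
  log_gain r - log_gain s.
Proof.
move=> s0 sr rT; have r0 := le_trans s0 sr.
have ds := dens s0.
have mw : measurable_fun D (w s) by apply: measurable_funTS; exact: measurable_weight.
have wb x : D x -> `|w s x| <= weight_bound.
  by move=> Dx; rewrite ger0_norm ?weight_ge0 ?weight_le.
have iw : mu.-integrable D (EFin \o (fun x => w s x * h x)).
  exact: integrable_densityM wb.
have [rs0 l0] : 0 <= r - s /\ 0 <= weight_lipschitz.
  by rewrite subr_ge0 weight_lipschitz_ge0.
(* [w s - m] is a lower bound for [w c - 1] over all times [c] in [s, r]. *)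
pose m := 1 + weight_lipschitz * (r - s).
have im : mu.-integrable D (EFin \o (fun x => w s x * h x - m * h x)).
  apply: (@integrableB _ _ _ mu D _ (EFin \o _) (EFin \o _)) => //.
  exact: density_integrableZ.
apply: (@le_trans _ _ (\int[mu]_(x in D) ((r - s) * (w s x * h x - m * h x)))).
  rewrite RintegralZl// (RintegralB _ iw (density_integrableZ _ h_density))//.
  rewrite (RintegralZl m _ (density_integrable h_density))//.
  rewrite (density_Rintegral h_density) mulr1.
  have := loss_convexity ds h_density.
  move: (\int[mu]_(x in D) _) (loss _) (loss _) => X l1 l2 lc.
  have -> : (r - s) * (X - m) = (r - s) * (X - 1) - weight_lipschitz * (r - s) ^+ 2.
    by rewrite /m; ring.
  by rewrite lerD2r ler_wpM2l.
rewrite /log_gain -RintegralB//; [|exact: log_gain_integrable..].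
apply: le_Rintegral => //.
- exact: (@integrableZl _ _ _ mu D _ _ (EFin \o _)).
- apply: (@integrableB _ _ _ mu D _ (EFin \o _) (EFin \o _)) => //;
    exact: log_gain_integrable.
move=> x Dx.
have [gs gr] := (solution_gt0 s0 Dx, solution_gt0 r0 Dx).
have : ln (g s x) + (w s x - m) * (r - s) <= ln (g r x).
  rewrite -[X in _ + X]expRK -lnM ?posrE ?expR_gt0//.
  rewrite ler_ln ?posrE ?mulr_gt0 ?expR_gt0//.
  apply: (C1_derivative_growth_ge (solution_C1 Dx) s0 sr) => c sc cr.
  have c0 := le_trans s0 sc.
  rewrite [leRHS]mulrC ler_wpM2r ?(density_ge0 (dens c0))//.
  rewrite /m opprD addrA addrAC; apply: lerB; last exact: lexx.
  rewrite lerBlDl -lerBlDr.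
  apply: le_trans (_ : weight_lipschitz * (c - s) <= _).
    apply: le_trans (ler_norm _) _; rewrite distrC.
    exact: weight_lipschitzP s0 sc (le_trans cr rT) Dx.
  by rewrite ler_wpM2l// lerB.
move=> lnge; have hx := density_ge0 h_density Dx.
have -> : (ln (g r x) - ln (g0 x)) * h x - (ln (g s x) - ln (g0 x)) * h x =
  (ln (g r x) - ln (g s x)) * h x by ring.
have -> : (r - s) * (w s x * h x - m * h x) = (w s x - m) * (r - s) * h x by ring.
by rewrite ler_wpM2r// lerBrDl.
Qed.

Lemma log_gain0 : log_gain 0 = 0.
Proof.
rewrite /log_gain (@eq_Rintegral _ _ _ mu D (cst 0)) => [|x /set_mem Dx].
  by rewrite /Rintegral integral0.
have [_ _ ->] := g_sol; last by move: Dx; rewrite /= in_itv.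
by rewrite subrr mul0r.
Qed.

Local Opaque log_gain.

(** Since the loss at earlier times is at least [loss (g T)], the step estimate
    shows that [log_gain s - s * (loss (g T) - loss h)] has only quadratic
    defects, hence is nondecreasing. *)
Lemma loss_gap_le_log_gain : T * (loss (g T) - loss h) <= log_gain T.
Proof.
pose k := loss (g T) - loss h; pose G s := log_gain s - s * k.
have T0 := ltW T_gt0.
have : G 0 <= G T.
  apply: (@nondecreasing_of_quadratic_defect _ G weight_lipschitz T) => //.
  move=> s r s0 sr rT.
  have : (r - s) * k - weight_lipschitz * (r - s) ^+ 2 <= log_gain r - log_gain s.
    apply: le_trans (log_gain_step s0 sr rT).
    apply: lerB; last exact: lexx.
    apply: ler_wpM2l; first by rewrite subr_ge0.
    apply: lerB; last exact: lexx.
    exact: loss_nonincreasing s0 (le_trans sr rT) (lexx T).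
  rewrite -subr_ge0 -[X in _ -> is_true X]subr_ge0 /G.
  by congr (0 <= _); ring.
by rewrite /G log_gain0 mul0r subr0 subr_ge0.
Qed.

End data.

(** * The convergence rate *)

Theorem theorem3p6 (R : realType) (M tau : R) (M_gt0 : 0 < M) (tau_gt0 : 0 < tau)
    (q : probability (measurableTypeR R) R)
    (q_exp : forall lambda : R,
      (\int[q]_phi (expR (lambda * phi))%:E < +oo)%E)
    (g0 : R -> R) (g0_density : density M g0)
    (g0_gt0 : forall theta : R, - M <= theta <= M -> 0 < g0 theta)
    (g : R -> R -> R) (g_sol : is_solution M tau q g0 g)
    (h : R -> R) (h_density : density M h) (t : R) (t_gt0 : 0 < t) :
  (Fbar M tau q (g t) - Fbar M tau q h <= kl_div M h g0 / t%:E)%E.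
Proof.
have t0 := ltW t_gt0.
have [dg _ _] := g_sol; have dgt := dg t t0.
rewrite !FbarE// -EFinB inver gt_eqF// lee_pdivlMr// -EFinM mulrC.
have g0pos x : (`[- M, M]%classic : set R) x -> 0 < g0 x.
  by rewrite /= in_itv; exact: g0_gt0.
have gt_pos x := solution_gt0 M_gt0 tau_gt0 q_exp g_sol g0_gt0 (theta := x) t0.
have bounded x := log_ratio_bound M_gt0 tau_gt0 q_exp g_sol g0_gt0 (x := x) t0.
apply: le_trans (kl_div_ge g0_density dgt h_density g0pos gt_pos bounded).
by rewrite lee_fin; exact: loss_gap_le_log_gain.
Qed.
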